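(* Let $L$ be a congruence normal lattice, obtained by a sequence of doublings $L_0,\ L_1=L_0[C_0],\ \dots,\ L_m=L_{m-1}[C_{m-1}]\cong L$, where $L_0$ is the one-element lattice and each $C_i$ is a non-empty convex subset of $L_i$. Then $L$ is left modular if and only if at each doubling step the heart of the doubled set has an element that lies on a maximal left modular chain, i.e. for every $i<m$ there is an element of $H(C_i)$ that lies on a maximal left modular chain of $L_i$.
   Context: All lattices are finite. An element $a$ of a lattice $L$ is left modular if for all $b<c$ in $L$, $(b\vee a)\wedge c=b\vee(a\wedge c)$. A maximal left modular chain is a maximal chain of $L$ all of whose elements are left modular. $L$ is left modular if it has a maximal left modular chain. A subset $C\subseteq L$ is convex if $x,y\in C$ implies $[x,y]\subseteq C$. Let $I_L(C)=\{y\in L\mid \exists x\in C,\ y\le x\}$. For a convex subset $C$ of $L$, the doubling $L[C]$ is the subposet of $L\times\{0<1\}$ on the subset $\big(I_L(C)\times\{0\}\big)\sqcup\big[\big((L\setminus I_L(C))\cup C\big)\times\{1\}\big]$; it is a lattice. A lattice is congruence normal if it is (up to isomorphism) obtained from the one-element lattice by successive doublings of convex subsets. The heart $H(C)$ of a convex subset $C$ is the set of elements of $C$ that are (weakly) smaller than all the maximal elements of $C$ and (weakly) bigger than all the minimal elements of $C$. *)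

(* Defs.v *)
From HB Require Import structures.
From mathcomp Require Import all_boot all_order.

Set Implicit Arguments.
Unset Strict Implicit.
Unset Printing Implicit Defensive.

Import Order.TTheory.
Local Open Scope order_scope.

Definition order_isomorphic (d d' : Order.disp_t)
    (P : porderType d) (Q : porderType d') : Prop :=
  exists f : P -> Q, bijective f /\ {mono f : x y / x <= y}.

Section Lattice.
Context {d : Order.disp_t} {L : finLatticeType d}.
Implicit Types (a b c x y z : L) (X C : {set L}).

Definition left_modular_elt a : bool :=
  [forall b, forall c, (b < c) ==> ((b `|` a) `&` c == b `|` (a `&` c))].

Definition is_chain X : bool :=
  [forall x in X, forall y in X, x >=< y].

Definition maximal_chain X : bool := maxset is_chain X.

Definition maximal_left_modular_chain X : bool :=
  maximal_chain X && [forall a in X, left_modular_elt a].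

Definition on_maximal_left_modular_chain a : Prop :=
  exists2 X : {set L}, maximal_left_modular_chain X & a \in X.

Definition convex C : bool :=
  [forall x in C, forall y in C, [set z | x <= z <= y] \subset C].

Definition downset C : {set L} := [set y | [exists x in C, y <= x]].

Definition maximal_elts C : {set L} :=
  [set x in C | [forall y in C, ~~ (x < y)]].

Definition minimal_elts C : {set L} :=
  [set x in C | [forall y in C, ~~ (y < x)]].

Definition heart C : {set L} :=
  [set x in C | [forall y in maximal_elts C, x <= y]
             && [forall y in minimal_elts C, y <= x]].

(* bool, ordered by false < true, plays the role of the chain {0 < 1}; [*p] is
   the product with the componentwise order. *)
Definition doubling_set C : {set L *p bool} :=
  setX (downset C) [set false] :|: setX (~: downset C :|: C) [set true].

Record doubling C : Type := Doubling {
  doubling_val :> L *p bool;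
  _ : doubling_val \in doubling_set C
}.

HB.instance Definition _ C := [isSub for @doubling_val C].
HB.instance Definition _ C := [Finite of doubling C by <:].
HB.instance Definition _ C := [SubChoice_isSubPOrder of doubling C by <:
  with Order.prod_display d Order.BoolOrder.bool_display].

End Lattice.

Definition left_modular_lattice (d : Order.disp_t) (L : finLatticeType d) : Prop :=
  exists X : {set L}, maximal_left_modular_chain X.

(* Main.v *)
(* The projection [L[C] -> L] is a surjective lattice morphism, so left modular
   elements of [L[C]] project to left modular elements of [L].  An element
   [(y, 0)] or [(y, 1)] over a left modular [y] fails to be left modular only
   through a pentagon with long side [(b, 0) < (b, 1)], [b] in [C]: the condition
   at level 0 is that [y `|` b] lies below [C] for every such [b], at level 1 that
   [y `&` b] lies in [C].

   If [x] in the heart lies on a maximal left modular chain [X], the elements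
   [(y, 0)], [y <= x], and [(y, 1)], [y >= x], for [y] in [X], form such a chain of
   [L[C]].  Conversely, in a maximal left modular chain of [L[C]], let [(p, 0)] be
   the last element at level 0 and [(q, 1)] the first one at level 1.  For [c] in
   [C] above [p], the element [z = q `&` c] is in [C] and [p <= z <= q], so [(z, 0)]
   and [(z, 1)] are on the chain by maximality, whence [p = z = q]; the two
   conditions above at [p] and [q] say precisely that [z] is in the heart.  This
   works for every finite lattice [L], and the theorem follows by induction. *)

Require Import Defs.
From mathcomp Require Import all_boot all_order.

Section LeftModularDoubling.

Set Implicit Arguments.
Unset Strict Implicit.
Unset Printing Implicit Defensive.

Import Order.TTheory.
Local Open Scope order_scope.

(** * Bounds, chains and maximal elements in finite lattices *)

Lemma seq_max (d : Order.disp_t) (P : porderType d) (s : seq P) (x : P) :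
  {in x :: s &, forall y z, y >=< z} ->
  exists2 y, y \in x :: s & {in x :: s, forall z, z <= y}.
Proof.
elim: s x => [|y s IHs] x cmp_s.
  by exists x; rewrite ?mem_head // => z; rewrite inE => /eqP->.
have [|z zs z_max] := IHs y.
  by move=> u v us vs; apply: cmp_s; rewrite inE (us, vs) orbT.
have zxs : z \in [:: x, y & s] by rewrite inE zs orbT.
have /orP[le_xz|le_zx] := cmp_s x z (mem_head _ _) zxs.
  by exists z => // u; rewrite inE => /predU1P[->|/z_max].
exists x; first exact: mem_head.
by move=> u; rewrite inE => /predU1P[->|/z_max le_uz] //; apply: le_trans le_zx.
Qed.

Lemma seq_lower_bound (d : Order.disp_t) (L : latticeType d) (s : seq L) (x : L) :
  exists y, {in s, forall z, y <= z}.
Proof.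
elim: s => [|z s [y y_min]]; first by exists x.
exists (y `&` z) => t; rewrite inE => /predU1P[->|/y_min le_yt]; first exact: leIr.
exact: leIxl.
Qed.

Section FiniteLattice.

Context {d : Order.disp_t} {L : finLatticeType d}.
Implicit Types (a b c x y z : L) (X Y C : {set L}).

Lemma ex_bottom x : exists y, forall z, y <= z.
Proof.
have [y y_min] := seq_lower_bound (enum L) x.
by exists y => z; apply: y_min; rewrite mem_enum.
Qed.

Lemma ex_top x : exists y, forall z, z <= y.
Proof.
have [y y_max] := @seq_lower_bound _ L^d (enum L) x.
by exists y => z; apply: y_max; rewrite mem_enum.
Qed.

Lemma is_chainP X :
  reflect {in X &, forall x y, x >=< y} (is_chain X).
Proof.
apply: (iffP forall_inP) => [chX x y Xx Xy | chX x Xx].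
  by have /forall_inP/(_ y Xy) := chX x Xx.
by apply/forall_inP => y Xy; apply: chX.
Qed.

Lemma is_chainS X Y : X \subset Y -> is_chain Y -> is_chain X.
Proof.
by move=> /subsetP sXY /is_chainP chY; apply/is_chainP => x y /sXY Yx /sXY; apply: chY.
Qed.

Let mem_cons_enum X x y : x \in X -> (y \in x :: enum X) = (y \in X).
Proof. by move=> Xx; rewrite inE mem_enum; case: eqP => // ->. Qed.

Lemma chain_max X x :
  is_chain X -> x \in X -> exists2 y, y \in X & {in X, forall z, z <= y}.
Proof.
move=> /is_chainP chX Xx; have [|y Xy y_max] := @seq_max _ L (enum X) x.
  by move=> y z; rewrite !mem_cons_enum //; apply: chX.
exists y => [|z Xz]; first by rewrite -(mem_cons_enum _ Xx).
by apply: y_max; rewrite mem_cons_enum.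
Qed.

Lemma chain_min X x :
  is_chain X -> x \in X -> exists2 y, y \in X & {in X, forall z, y <= z}.
Proof.
move=> /is_chainP chX Xx; have [|y Xy y_min] := @seq_max _ L^d (enum X) x.
  move=> y z Xy Xz; apply: (chX z y); rewrite -(mem_cons_enum _ Xx) //.
exists y => [|z Xz]; first by rewrite -(mem_cons_enum _ Xx).
by apply: y_min; rewrite mem_cons_enum.
Qed.

(** By induction on the number of elements of [X] strictly above [x], which drops when [x] is
    replaced by one of them. *)
Lemma ex_maximal_ge X x :
  x \in X -> exists y, (y \in maximal_elts X) && (x <= y).
Proof.
have [n] := ubnP #|[set y in X | x < y]|; elim: n x => // n IHn x le_n Xx.
have [/forall_inP no_y | /forall_inPn[y Xy /negbNE lt_xy]] :=
    boolP [forall y in X, ~~ (x < y)].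
  by exists x; rewrite inE Xx lexx andbT; apply/forall_inP.
have [|z /andP[max_z le_yz]] := IHn y _ Xy; last first.
  by exists z; rewrite max_z (le_trans (ltW lt_xy)).
apply: leq_trans (ltnSE le_n); apply: proper_card; apply/properP; split.
  by apply/subsetP => z; rewrite !inE => /andP[-> /(lt_trans lt_xy)].
by exists y; rewrite !inE ?Xy ?ltxx.
Qed.

(** Adding an element comparable with the whole chain gives a larger chain, so maximality can be
    tested one element at a time. *)
Lemma maximal_chainP X :
  reflect (is_chain X /\ forall z, {in X, forall x, z >=< x} -> z \in X)
          (maximal_chain X).
Proof.
apply: (iffP maxsetP) => [[chX maxX] | [chX maxX]]; split => //.
  move=> z cmp_z; rewrite -(maxX (z |: X)) ?setU11 ?subsetUr //.
  apply/is_chainP => x y /setU1P[->|Xx] /setU1P[->|Xy].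
  - exact: comparablexx.
  - exact: cmp_z.
  - by rewrite comparable_sym; apply: cmp_z.
  - exact: (is_chainP _ chX).
move=> Y /is_chainP chY /subsetP sXY; apply/setP => z; apply/idP/idP; last exact: sXY.
by move=> Yz; apply: maxX => x /sXY; apply: chY.
Qed.

(** * Left modular elements *)

Lemma left_modular_law a :
  reflect (forall b c, b <= c -> (b `|` a) `&` c = b `|` (a `&` c))
          (left_modular_elt a).
Proof.
apply: (iffP forallP) => [lma b c | lma b].
  (* The definition covers [b < c]; for [b = c] both sides equal [b] by absorption. *)
  rewrite le_eqVlt => /predU1P[<- | lt_bc]; last first.
    by have /forallP/(_ c)/implyP/(_ lt_bc)/eqP := lma b.
  by rewrite meetC joinKI [a `&` b]meetC meetKU.
by apply/forallP => c; apply/implyP => /ltW/lma/eqP.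
Qed.

(* A failure of the modular law at [b <= c] yields a pentagon with short side
   [a] and long side [b `|` (a `&` c) < (b `|` a) `&` c]. *)
Lemma left_modular_pentagonP a :
  reflect (forall b c, b <= c -> a `|` b = a `|` c -> a `&` b = a `&` c -> b = c)
          (left_modular_elt a).
Proof.
apply: (iffP (left_modular_law a)) => lma b c le_bc.
  move=> eqU eqI; have := lma b c le_bc.
  by rewrite joinC eqU -eqI joinIK [a `&` b]meetC meetKU => ->.
have le_b : b <= (b `|` a) `&` c by rewrite lexI leUl.
have le_c : b `|` (a `&` c) <= c by rewrite leUx le_bc leIr.
apply/esym/lma.
- by rewrite leUx le_b lexI leIr (leIxl _ (leUr _ _)).
- rewrite joinCA meetKU; apply/le_anti; rewrite !leUx leUl (lexUr _ le_b) /=.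
  by rewrite leUr (leIxl _ (lexx _)).
- rewrite meetA [b `|` a]joinC joinKI; apply/le_anti.
  by rewrite !lexI !leIl (leIxr _ le_c) leUr.
Qed.

End FiniteLattice.

Lemma ex_minimal_le (d : Order.disp_t) (L : finLatticeType d) (X : {set L}) (x : L) :
  x \in X -> exists y, (y \in minimal_elts X) && (y <= x).
Proof. exact: (@ex_maximal_ge _ L^d). Qed.

(** * Transfer along surjective morphisms and isomorphisms *)

Section Transfer.

Context {d d' : Order.disp_t} {L : finLatticeType d} {L' : finLatticeType d'}.

Lemma left_modular_elt_morph (f : L' -> L) (a : L') :
  {morph f : x y / x `|` y} -> {morph f : x y / x `&` y} ->
  (forall y, exists x, f x = y) ->
  left_modular_elt a -> left_modular_elt (f a).
Proof.
move=> fU fI f_onto /left_modular_law lma.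
apply/left_modular_law => b c le_bc.
have [[b' def_b] [c' def_c]] := (f_onto b, f_onto c).
have /meet_idPl fbc : f b' <= f c' by rewrite def_b def_c.
(* The lifts [b'] and [c'] need not be comparable, but the meet of the two lies below [c'] and still
   maps to [b]. *)
have := congr1 f (lma (b' `&` c') c' (leIr _ _)).
by rewrite !(fU, fI) fbc def_b def_c.
Qed.

Lemma left_modular_lattice_iso :
  order_isomorphic L' L -> left_modular_lattice L' -> left_modular_lattice L.
Proof.
case=> f [[g fK gK] f_mono] [X /andP[/maximal_chainP[/is_chainP chX maxX] lmX]].
have g_mono : {mono g : x y / x <= y}.
  by move=> x y; rewrite -{2}[x]gK -{2}[y]gK f_mono.
exists (f @: X); apply/andP; split.
  apply/maximal_chainP; split=> [|z cmp_z].
    apply/is_chainP=> _ _ /imsetP[x Xx ->] /imsetP[y Xy ->].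
    by rewrite /Order.comparable !f_mono; apply: chX.
  rewrite -[z]gK imset_f //; apply: maxX => x Xx.
  by rewrite /Order.comparable -[x]fK !g_mono; apply: cmp_z; apply: imset_f.
apply/forall_inP=> _ /imsetP[x Xx ->]; apply: left_modular_elt_morph.
- move=> u v; apply/le_anti; rewrite leUx !f_mono leUl leUr andbT.
  by rewrite -[f u `|` f v]gK f_mono leUx -![_ <= g _]f_mono gK leUl leUr.
- move=> u v; apply/le_anti; rewrite lexI !f_mono leIl leIr.
  by rewrite -[f u `&` f v]gK f_mono lexI -![g _ <= _]f_mono gK leIl leIr.
- by move=> y; exists (g y).
exact: (forall_inP lmX).
Qed.

End Transfer.

Lemma order_isomorphic_sym (d d' : Order.disp_t) (P : porderType d)
    (Q : porderType d') : order_isomorphic P Q -> order_isomorphic Q P.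
Proof.
case=> f [[g fK gK] f_mono]; exists g; split; first by exists f.
by move=> x y; rewrite -{2}[x]gK -{2}[y]gK f_mono.
Qed.

(** Membership of [(z, e)] in [doubling_set C], written so that it simplifies once the level [e] is
    known. *)
Definition in_doubling (d : Order.disp_t) (L : finLatticeType d) (C : {set L})
    (z : L) (e : bool) : bool :=
  if e then (z \notin downset C) || (z \in C) else z \in downset C.

(** * Convex sets inside their down-sets *)

Section Downset.

Context {d : Order.disp_t} {L : finLatticeType d} (C : {set L}).
Implicit Types x y z : L.

Lemma mem_downset x : x \in C -> x \in downset C.
Proof. by move=> Cx; rewrite inE; apply/exists_inP; exists x. Qed.

Lemma downset_le x y : x <= y -> y \in downset C -> x \in downset C.
Proof.
move=> le_xy; rewrite !inE => /exists_inP[z Cz le_yz].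
by apply/exists_inP; exists z => //; apply: le_trans le_yz.
Qed.

Lemma downsetP x : reflect (exists2 y, y \in C & x <= y) (x \in downset C).
Proof. by rewrite inE; apply: exists_inP. Qed.

Hypothesis convexC : convex C.

Lemma convex_mem x y z : x \in C -> y \in C -> x <= z -> z <= y -> z \in C.
Proof.
move=> Cx Cy le_xz le_zy; have /forall_inP/(_ y Cy)/subsetP := forall_inP convexC x Cx.
by apply; rewrite inE le_xz.
Qed.

(** A convex set is upward closed within its down-set; this is the main form in which convexity is
    used. *)
Lemma convex_downset x z : x \in C -> x <= z -> z \in downset C -> z \in C.
Proof. by move=> Cx le_xz /downsetP[y Cy]; apply: convex_mem le_xz. Qed.

End Downset.

(** * Joins and meets in a doubling *)

Section Doubling.

(* [pi] and [ep] are the coordinates of an isomorphism from [L'] to [doubling C];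
   working in [L'] makes joins and meets available. *)
Context {d d' : Order.disp_t} {L : finLatticeType d} {L' : finLatticeType d'}.
Context {C : {set L}} (convexC : convex C) (C_neq0 : C != set0).
Context (pi : L' -> L) (ep : L' -> bool).
Context (le_pe : forall x y, (x <= y) = (pi x <= pi y) && (ep x ==> ep y)).
Context (pe_in : forall x, in_doubling C (pi x) (ep x)).
Context (pe_onto : forall z e, in_doubling C z e ->
                     exists x, pi x = z /\ ep x = e).

Lemma pe_inj x y : pi x = pi y -> ep x = ep y -> x = y.
Proof.
by move=> pi_xy ep_xy; apply/le_anti; rewrite !le_pe pi_xy ep_xy lexx implybb.
Qed.

Lemma pi_onto z : exists x, pi x = z.
Proof.
have [e /pe_onto[x [<- _]]] : exists e, in_doubling C z e; last by exists x.
by exists (z \notin downset C); rewrite /in_doubling; case: (boolP (z \in _)).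
Qed.

(** The join is componentwise, except that outside the down-set only level 1 exists. If one argument
    has level 1 and the join projects into the down-set, convexity puts that projection in [C], so
    level 1 is available. *)
Lemma pe_join x y :
  pi (x `|` y) = pi x `|` pi y /\
  ep (x `|` y) = [|| ep x, ep y | pi x `|` pi y \notin downset C].
Proof.
have /pe_onto[w [pi_w ep_w]] : in_doubling C (pi x `|` pi y)
    [|| ep x, ep y | pi x `|` pi y \notin downset C].
  rewrite /in_doubling; case: (boolP (_ \in downset C)) => /= [IC|_];
    last by rewrite !orbT.
  rewrite orbF; case ep_xy: (ep x || ep y) => //.
  case/orP: ep_xy => ep1; [have := pe_in x | have := pe_in y]; rewrite /in_doubling ep1.
    rewrite (downset_le (leUl _ _) IC) /= => /convex_downset; apply=> //; exact: leUl.
  rewrite (downset_le (leUr _ _) IC) /= => /convex_downset; apply=> //; exact: leUr.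
suffices -> : x `|` y = w by [].
apply/le_anti; rewrite leUx !le_pe pi_w ep_w leUl leUr /=.
have := leUl x y; have := leUr y x; rewrite !le_pe => /andP[le_y ep_y] /andP[le_x ep_x].
rewrite leUx le_x le_y; have := pe_in (x `|` y); move: ep_x ep_y.
case: (ep x) => //=; case: (ep y) => //=; case: (ep _) => //=.
- by rewrite !implybT.
by move=> _ _ /(downset_le _) ->; rewrite // leUx le_x.
Qed.

(** The meet is componentwise, except that it drops to level 0 when its projection lies in the
    down-set but not in [C]. *)
Lemma pe_meet x y :
  pi (x `&` y) = pi x `&` pi y /\
  ep (x `&` y) = [&& ep x, ep y & in_doubling C (pi x `&` pi y) true].
Proof.
have /pe_onto[w [pi_w ep_w]] : in_doubling C (pi x `&` pi y)
    [&& ep x, ep y & in_doubling C (pi x `&` pi y) true].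
  case in1: (in_doubling _ _ true); last first.
    by rewrite !andbF; move: in1; rewrite /in_doubling; case: (_ \in downset C).
  rewrite andbT; have [ep1 | /nandP[] ep1] := boolP (ep x && ep y) => //.
    have := pe_in x; rewrite (negPf ep1); apply: downset_le; exact: leIl.
  have := pe_in y; rewrite (negPf ep1); apply: downset_le; exact: leIr.
suffices -> : x `&` y = w by [].
apply/le_anti; rewrite lexI !le_pe pi_w ep_w leIl leIr /= andbC.
have := leIl x y; have := leIr y x; rewrite !le_pe => /andP[le_y ep_y] /andP[le_x ep_x].
have pi_le : pi (x `&` y) <= pi x `&` pi y by rewrite lexI le_x.
rewrite pi_le; have := pe_in (x `&` y); move: ep_x ep_y.
case: (ep (x `&` y)) => /=; last first.
  by case: (ep x); case: (ep y) => //=; rewrite ?implybT.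
move=> -> -> /=; rewrite /in_doubling !implybT /= => /orP[nIC | Cxy].
  by rewrite (contraNN (downset_le pi_le) nIC).
case: (boolP (_ \in downset C)) => //= IC.
exact: (convex_downset convexC Cxy pi_le).
Qed.

Let piU x y : pi (x `|` y) = pi x `|` pi y := (pe_join x y).1.
Let piI x y : pi (x `&` y) = pi x `&` pi y := (pe_meet x y).1.
Let epU x y := (pe_join x y).2.
Let epI x y := (pe_meet x y).2.

(** * Maximal left modular chains of a doubling *)

Lemma pi_comparable x y : x >=< y -> pi x >=< pi y.
Proof.
case/orP; rewrite le_pe => /andP[le_xy _]; rewrite /Order.comparable le_xy //.
by rewrite orbT.
Qed.

Lemma pi_maximal_left_modular_chain (Y : {set L'}) :
  maximal_left_modular_chain Y -> maximal_left_modular_chain (pi @: Y).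
Proof.
move=> /andP[/maximal_chainP[/is_chainP chY maxY] lmY].
apply/andP; split; last first.
  apply/forall_inP=> _ /imsetP[y Yy ->].
  by apply: left_modular_elt_morph => //; [apply: pi_onto | apply: (forall_inP lmY)].
apply/maximal_chainP; split.
  by apply/is_chainP=> _ _ /imsetP[x Xx ->] /imsetP[y Xy ->]; apply/pi_comparable/chY.
move=> z cmp_z; apply: contraT => Yz.
have cmp_pi y : y \in Y -> (pi y < z) || (z < pi y).
  move=> Yy; have := cmp_z (pi y) (imset_f _ Yy).
  rewrite /Order.comparable !le_eqVlt; have [eq_z | _] := eqVneq z (pi y).
    by rewrite eq_z imset_f in Yz.
  by rewrite orFb orbC.
(* [(z, e)] is comparable with the whole chain for a suitable level [e]. *)
have [e in_z cmp_e] : exists2 e, in_doubling C z e &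
    {in Y, forall y, (pi y < z -> ep y ==> e) /\ (z < pi y -> e ==> ep y)}.
  case: (boolP (z \in downset C)) => [Iz | nIz]; last first.
    exists true => [|y Yy]; first by rewrite /= nIz.
    split=> [_|lt_zy]; first exact: implybT.
    have := pe_in y; case: (ep y) => //= Iy.
    by rewrite (downset_le (ltW lt_zy) Iy) in nIz.
  case: (boolP (z \in C)) => [Cz | nCz]; last first.
    exists false => // y Yy; split=> // lt_yz.
    have := pe_in y; case: (ep y) => //=; rewrite (downset_le (ltW lt_yz) Iz) /= => Cy.
    by rewrite (convex_downset convexC Cy (ltW lt_yz) Iz) in nCz.
  (* Over [z] in [C] both levels exist. Level 1 is chosen exactly when the chain has a level 1
     element projecting below [z]; being a chain, it then has level 1 everywhere above [z]. *)
  have [/exists_inP[y Yy /andP[lt_yz ep_y]] | /exists_inPn noY] :=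
    boolP [exists y in Y, (pi y < z) && ep y].
    exists true => [|u Yu]; first by rewrite /= Cz orbT.
    split=> [_|lt_zu]; first exact: implybT.
    have := chY y u Yy Yu; rewrite /Order.comparable !le_pe ep_y.
    by rewrite [pi u <= _]lt_geF ?(lt_trans lt_yz) ?orbF //= => /andP[].
  exists false => // y Yy; split=> // lt_yz.
  by have := noY y Yy; rewrite lt_yz implybF.
have [w [pi_w ep_w]] := pe_onto in_z.
have Yw : w \in Y.
  apply: maxY => y Yy; have [le_y ge_y] := cmp_e y Yy.
  rewrite /Order.comparable !le_pe pi_w ep_w.
  by case/orP: (cmp_pi y Yy) => lt_; rewrite (ltW lt_) ?(le_y lt_) ?(ge_y lt_) ?orbT.
by rewrite -pi_w imset_f in Yz.
Qed.

(** The two lifts of [b] have the same meet with [p], at level 0. Were the join outside the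
    down-set, their joins with [p] would agree at level 1, and the pentagon criterion would identify
    the lifts. *)
Lemma left_modular_join_downset p b :
  ~~ ep p -> left_modular_elt p -> b \in C -> pi p `|` b \in downset C.
Proof.
move=> /negPf ep_p /left_modular_pentagonP lmp Cb; apply: contraT => nIpb.
have [|b0 [pi_b0 ep_b0]] := @pe_onto b false; first exact: mem_downset.
have [|b1 [pi_b1 ep_b1]] := @pe_onto b true; first by rewrite /= Cb orbT.
suffices eq_b : b0 = b1 by rewrite -ep_b0 eq_b ep_b1.
apply: lmp; first by rewrite le_pe pi_b0 pi_b1 ep_b0 lexx.
  by apply: pe_inj; rewrite ?piU ?epU pi_b0 pi_b1 // nIpb !orbT.
by apply: pe_inj; rewrite ?piI ?epI pi_b0 pi_b1 // ep_p.
Qed.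

(** Here the joins of the two lifts with [q] agree at level 1. A meet outside [C] would still be in
    the down-set, forcing both meets to level 0. *)
Lemma left_modular_meet_in q b :
  ep q -> left_modular_elt q -> b \in C -> pi q `&` b \in C.
Proof.
move=> ep_q /left_modular_pentagonP lmq Cb; apply: contraT => nCqb.
have [|b0 [pi_b0 ep_b0]] := @pe_onto b false; first exact: mem_downset.
have [|b1 [pi_b1 ep_b1]] := @pe_onto b true; first by rewrite /= Cb orbT.
suffices eq_b : b0 = b1 by rewrite -ep_b0 eq_b ep_b1.
have Iqb : pi q `&` b \in downset C by apply: downset_le (mem_downset Cb); apply: leIr.
apply: lmq; first by rewrite le_pe pi_b0 pi_b1 ep_b0 lexx.
  by apply: pe_inj; rewrite ?piU ?epU pi_b0 pi_b1 // ep_q.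
apply: pe_inj; rewrite ?piI ?epI pi_b0 pi_b1 //.
by rewrite /in_doubling Iqb (negPf nCqb) !andbF.
Qed.

Lemma heart_of_left_modular_doubling :
  left_modular_lattice L' ->
  exists2 x, x \in heart C & on_maximal_left_modular_chain x.
Proof.
case=> Y mlmY; have /andP[/maximal_chainP[chY maxY] /forall_inP lmY] := mlmY.
(* The two lifts of [c0] show that the bottom has level 0 and the top level 1, so the chain has
   elements at both levels. *)
have /set0Pn[c0 Cc0] := C_neq0.
have lift0 c : c \in C -> exists x, pi x = c /\ ep x = false.
  by move=> Cc; apply: pe_onto; apply: mem_downset.
have lift1 c : c \in C -> exists x, pi x = c /\ ep x = true.
  by move=> Cc; apply: pe_onto; rewrite /= Cc orbT.
have [u [_ ep_u]] := lift0 c0 Cc0; have [v [_ ep_v]] := lift1 c0 Cc0.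
have [bot bot_min] := ex_bottom u; have [top top_max] := ex_top u.
have ep_bot : ~~ ep bot.
  by have := bot_min u; rewrite le_pe ep_u implybF => /andP[].
have ep_top : ep top by have := top_max v; rewrite le_pe ep_v => /andP[].
have Ybot : bot \in Y by apply: maxY => y _; rewrite /Order.comparable bot_min.
have Ytop : top \in Y by apply: maxY => y _; rewrite /Order.comparable top_max orbT.
have [||p] := @chain_max _ _ [set y in Y | ~~ ep y] bot.
- by apply: is_chainS chY; apply/subsetP=> y; rewrite inE => /andP[].
- by rewrite inE Ybot ep_bot.
rewrite inE => /andP[Yp ep_p] p_max.
have [||q] := @chain_min _ _ [set y in Y | ep y] top.
- by apply: is_chainS chY; apply/subsetP=> y; rewrite inE => /andP[].
- by rewrite inE Ytop ep_top.
rewrite inE => /andP[Yq ep_q] q_min.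
have le_pq : pi p <= pi q.
  have := is_chainP _ chY p q Yp Yq.
  by rewrite /Order.comparable !le_pe ep_q (negPf ep_p) andbF orbF => /andP[].
have /downsetP[c Cc le_pc] : pi p \in downset C.
  by have := pe_in p; rewrite (negPf ep_p).
pose z := pi q `&` c.
have Cz : z \in C by apply: left_modular_meet_in (lmY q Yq) Cc.
have le_pz : pi p <= z by rewrite lexI le_pq.
have le_zq : z <= pi q by apply: leIl.
(* Chain elements at level 1 lie above [q] and those at level 0 below [p], so either lift of [z] is
   comparable with all of them. *)
have cmp_z w : pi w = z -> w \in Y.
  move=> pi_w; apply: maxY => y Yy; rewrite /Order.comparable !le_pe pi_w.
  case ep_y: (ep y).
    have := q_min y; rewrite inE Yy ep_y le_pe => /(_ isT)/andP[le_qy _].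
    by rewrite (le_trans le_zq le_qy) implybT.
  have := p_max y; rewrite inE Yy ep_y le_pe => /(_ isT)/andP[le_yp _].
  by rewrite (le_trans le_yp le_pz) orbT.
have zp : z = pi p.
  have [w [pi_w ep_w]] := lift0 z Cz.
  have := p_max w; rewrite inE cmp_z // ep_w le_pe pi_w => /(_ isT)/andP[le_zp _].
  by apply/le_anti; rewrite le_zp.
have zq : z = pi q.
  have [w [pi_w ep_w]] := lift1 z Cz.
  have := q_min w; rewrite inE cmp_z // ep_w le_pe pi_w => /(_ isT)/andP[le_qz _].
  by apply/le_anti; rewrite le_qz le_zq.
exists z; last first.
  by exists (pi @: Y); [apply: pi_maximal_left_modular_chain | rewrite zp imset_f].
rewrite inE Cz /=; apply/andP; split; apply/forall_inP => y; rewrite inE.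
  (* The join of [z] with a maximal [y] stays in the down-set, hence in [C], hence equals [y].
     Minimal elements are treated dually, with meets. *)
  move=> /andP[Cy /forall_inP/(_ (z `|` y))]; rewrite lt_neqAle leUr andbT negbK.
  move=> max_y; apply/join_idPr/esym/eqP/max_y.
  apply: (convex_downset convexC Cy (leUr _ _)).
  by rewrite zp (left_modular_join_downset ep_p (lmY p Yp)).
move=> /andP[Cy /forall_inP/(_ (z `&` y))]; rewrite lt_neqAle leIr andbT negbK.
move=> min_y; apply/meet_idPr/eqP/min_y.
by rewrite zq (left_modular_meet_in ep_q (lmY q Yq)).
Qed.

Lemma heart_left_modular_doubling x :
  x \in heart C -> on_maximal_left_modular_chain x -> left_modular_lattice L'.
Proof.
rewrite inE => /and3P[Cx /forall_inP x_max /forall_inP x_min].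
case=> X /andP[/maximal_chainP[/is_chainP chX maxX] /forall_inP lmX] Xx.
have [x0 [pi_x0 ep_x0]] := @pe_onto x false (mem_downset Cx).
have [|x1 [pi_x1 ep_x1]] := @pe_onto x true; first by rewrite /= Cx orbT.
exists [set y | (pi y \in X) && (if ep y then x <= pi y else pi y <= x)].
apply/andP; split.
  apply/maximal_chainP; split=> [|z cmp_z].
    apply/is_chainP => y y'; rewrite !inE => /andP[Xy le_y] /andP[Xy' le_y'].
    have := chX _ _ Xy Xy'; rewrite /Order.comparable !le_pe.
    case: (ep y) le_y; case: (ep y') le_y' => /= le_1 le_2; rewrite ?andbT //.
      by rewrite (le_trans le_1 le_2) !orbT.
    by rewrite (le_trans le_2 le_1).
  rewrite inE; apply/andP; split.
    (* Each [u] in [X] lifts into the new chain, at a level given by its side of [x], so the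
       projection of [z] is comparable with it. *)
    apply: maxX => u Xu; have /orP[le_ux|le_xu] := chX u x Xu Xx.
      have [|y [pi_y ep_y]] := @pe_onto u false.
        exact: downset_le le_ux (mem_downset Cx).
      rewrite -pi_y; apply: pi_comparable; apply: cmp_z.
      by rewrite inE pi_y ep_y Xu.
    have [|y [pi_y ep_y]] := @pe_onto u true.
      rewrite /=; case: (boolP (u \in downset C)) => //= Iu.
      exact: (convex_downset convexC Cx le_xu).
    rewrite -pi_y; apply: pi_comparable; apply: cmp_z.
    by rewrite inE pi_y ep_y Xu.
  (* Comparing [z] with the lift of [x] at the opposite level decides on which side of [x] it
     projects. *)
  case ep_z: (ep z).
    have := cmp_z x0; rewrite inE pi_x0 ep_x0 Xx lexx => /(_ isT).
    by rewrite /Order.comparable !le_pe pi_x0 ep_x0 ep_z andbF andbT.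
  have := cmp_z x1; rewrite inE pi_x1 ep_x1 Xx lexx => /(_ isT).
  by rewrite /Order.comparable !le_pe pi_x1 ep_x1 ep_z andbF andbT orbF.
apply/forall_inP => y; rewrite inE => /andP[/lmX/left_modular_pentagonP lmy le_y].
apply/left_modular_pentagonP => b c.
rewrite le_pe => /andP[le_bc ep_bc] eqU eqI.
(* A pentagon must collapse in [L], so only the levels of [b] and [c] can differ. *)
have pi_bc : pi b = pi c.
  apply: lmy => //; first by rewrite -!piU eqU.
  by rewrite -!piI eqI.
apply: pe_inj => //; move: ep_bc.
case ep_b: (ep b); case ep_c: (ep c) => //= _.
have Cb : pi b \in C.
  have := pe_in b; have := pe_in c; rewrite ep_b ep_c -pi_bc /in_doubling.
  by case: (_ \in downset C).
(* At level 1, [x] and hence [pi y] lie above a minimal [w] below [pi b]; the meet with [pi b] is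
   then in [C], and the meets of [y] with [b] and [c] have different levels. At level 0 a maximal
   [w] above [pi b] does the same for joins. *)
case ep_y: (ep y) le_y => le_y.
  have [w /andP[min_w le_wb]] : exists w, (w \in minimal_elts C) && (w <= pi b).
    exact: ex_minimal_le.
  have Cw : w \in C by move: min_w; rewrite inE => /andP[].
  have Cyb : pi y `&` pi b \in C.
    apply: (convex_mem convexC Cw Cb _ (leIr _ _)).
    by rewrite lexI le_wb (le_trans (x_min w min_w)).
  have := congr1 ep eqI; rewrite !epI ep_y ep_b ep_c -pi_bc /in_doubling Cyb.
  by rewrite orbT.
have [w /andP[max_w le_bw]] : exists w, (w \in maximal_elts C) && (pi b <= w).
  exact: ex_maximal_ge.
have Cw : w \in C by move: max_w; rewrite inE => /andP[].
have Iyb : pi y `|` pi b \in downset C.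
  by apply/downsetP; exists w; rewrite // leUx le_bw (le_trans le_y) ?x_max.
by have := congr1 ep eqU; rewrite !epU ep_y ep_b ep_c -pi_bc Iyb.
Qed.

End Doubling.

(** * One doubling step, and the sequence of doublings *)

Lemma left_modular_doubling (d d' : Order.disp_t) (L : finLatticeType d)
    (L' : finLatticeType d') (C : {set L}) :
  C != set0 -> convex C -> order_isomorphic L' (doubling C) ->
  left_modular_lattice L' <->
  exists2 x, x \in heart C & on_maximal_left_modular_chain x.
Proof.
move=> C_neq0 convexC [f [[g fK gK] f_mono]].
pose pi x := (doubling_val (f x)).1; pose ep x := (doubling_val (f x)).2.
have in_doublingE z e : ((z, e) \in doubling_set C) = in_doubling C z e.
  by rewrite !inE /=; case: e; rewrite ?andbF ?andbT ?orbF // /in_doubling inE.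
have le_pe x y : (x <= y) = (pi x <= pi y) && (ep x ==> ep y).
  rewrite -f_mono; change ((doubling_val (f x) <= doubling_val (f y)) =
    (pi x <= pi y) && (ep x ==> ep y)).
  by rewrite leEprod; congr (_ && _); rewrite /ep; case: (_.2); case: (_.2).
have pe_in x : in_doubling C (pi x) (ep x).
  rewrite -in_doublingE /pi /ep; case: (f x) => [[z e]]; exact.
have pe_onto z e : in_doubling C z e -> exists x, pi x = z /\ ep x = e.
  by rewrite -in_doublingE => zeP; exists (g (Doubling zeP)); rewrite /pi /ep gK.
split; first exact: (heart_of_left_modular_doubling convexC C_neq0 le_pe).
case=> x; exact: (heart_left_modular_doubling convexC le_pe).
Qed.

Lemma left_modular_lattice_card1 (d : Order.disp_t) (L : finLatticeType d) :
  #|L| = 1%N -> left_modular_lattice L.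
Proof.
move=> /eqP/fintype1P[x all_x]; exists setT; apply/andP; split.
  apply/maximal_chainP; split=> [|y _]; last by rewrite inE.
  by apply/is_chainP => y z _ _; rewrite (all_x y) (all_x z) comparablexx.
apply/forall_inP => a _; apply/left_modular_pentagonP => b c _ _ _.
by rewrite (all_x b) (all_x c).
Qed.

End LeftModularDoubling.

Theorem theorem3p7 (d : Order.disp_t) (L : finLatticeType d) (m : nat)
    (disp : nat -> Order.disp_t)
    (L_ : forall i : nat, finLatticeType (disp i))
    (C : forall i : nat, {set L_ i})
    (L0_one : #|L_ 0| = 1)
    (C_nonempty : forall i : nat, i < m -> C i != set0)
    (C_convex : forall i : nat, i < m -> convex (C i))
    (L_doubling : forall i : nat, i < m ->
       order_isomorphic (L_ i.+1) (doubling (C i)))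
    (L_last : order_isomorphic (L_ m) L) :
  left_modular_lattice L <->
  (forall i : nat, i < m ->
     exists2 x : L_ i, x \in heart (C i) & on_maximal_left_modular_chain x).
Proof.
have step i (lt_im : i < m) := left_modular_doubling (C_nonempty i lt_im)
  (C_convex i lt_im) (L_doubling i lt_im).
have isoL : left_modular_lattice L <-> left_modular_lattice (L_ m).
  by split; apply: left_modular_lattice_iso; first exact: order_isomorphic_sym.
apply: (iff_trans isoL); split=> [lmL i lt_im | heartP]; last first.
  (* For [m = n.+1] the heart condition at step [n] gives left modularity of [L_ m] directly; for
     [m = 0] the lattice has one element. *)
  case: m step heartP {isoL L_last C_nonempty C_convex L_doubling} => [|n] step heartP.
    by apply: left_modular_lattice_card1.
  by apply/(step n)/heartP.
(* Here [j] counts steps down from [m]: left modularity after a doubling yields a maximal left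
   modular chain before it. *)
have descend j : j <= m -> left_modular_lattice (L_ (m - j)).
  elim: j => [|j IHj] lt_jm; first by rewrite subn0.
  have lt_m : m - j.+1 < m by rewrite ltn_subrL (leq_ltn_trans _ lt_jm).
  have [|x _ [X mlmX _]] := (step _ lt_m).1; last by exists X.
  by rewrite subnSK //; apply: IHj; apply: ltnW.
apply/(step i lt_im); rewrite -(subKn lt_im); apply: descend; exact: leq_subr.
Qed.
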